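(* Let $n \geq 2$ and let $\sigma$ be an integer with $2 \leq \sigma \leq (n+3)/2$. Then there exists a string $T$ of length $n$ over an alphabet of size $\sigma$ such that $|\mathcal{PS}_T| = n + \sigma - 2$.
   Context: For a string $S$ of length $n$ and $1 \le i \le j \le n$, $S[i..j]$ is the substring from position $i$ to position $j$, and $\#\mathit{occ}_S(w)$ is the number of positions $i$ with $S[i..i+|w|-1]=w$. A non-empty substring $w$ is unique if $\#\mathit{occ}_S(w)=1$ and repeating if $\#\mathit{occ}_S(w)\ge 2$; an interval $[i,j]$ is called unique/repeating according to $S[i..j]$. For intervals, $[s,t]\subset[i,j]$ means $i\le s$ and $t\le j$. For an interval $[s,t]$, an interval $[i,j]$ is a shortest unique substring (SUS) for $[s,t]$ if (1) $S[i..j]$ is unique, (2) $[s,t]\subset[i,j]$, and (3) $S[i'..j']$ is repeating for every $[i',j']$ with $[s,t]\subset[i',j']$ and $j'-i'<j-i$. $\mathsf{SUS}_S(p)$ denotes the set of SUSs for $[p,p]$, and $\mathcal{PS}_S=\bigcup_{p=1}^{n}\mathsf{SUS}_S(p)$ is the set of all point SUSs of $S$.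
   Formalization: The formal statement excludes the single pair n = 3, σ = 3, for which the claim is false: every string of length 3 has at most 3 point SUSs, while n + σ − 2 = 4. *)

(* Defs.v *)
From mathcomp Require Import all_boot.

Set Implicit Arguments.
Unset Strict Implicit.
Unset Printing Implicit Defensive.

(* Positions are numbered from 0: a string S of length n has positions 'I_n,
   and the interval [i, j] (both ends included) is the pair (i, j) with
   i <= j.  Pairs with j < i are not intervals. *)

Section PointSUS.

Variables (A : eqType) (n : nat).
Implicit Types (S : n.-tuple A) (w : seq A) (I J : 'I_n * 'I_n) (p : 'I_n).

Definition is_interval I : bool := I.1 <= I.2.

Definition substring S I : seq A := take (I.2.+1 - I.1) (drop I.1 S).

(* An occurrence running past the end of S yields a truncated [take], which
   differs from w by its size. *)
Definition nocc S w : nat :=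
  #|[set i : 'I_n | take (size w) (drop i S) == w]|.

Definition unique S I : bool :=
  is_interval I && (nocc S (substring S I) == 1).

Definition repeating S I : bool :=
  is_interval I && (2 <= nocc S (substring S I)).

Definition subinterval J I : bool := (I.1 <= J.1) && (J.2 <= I.2).

Definition is_SUS S J I : bool :=
  [&& unique S I, subinterval J I &
      [forall I' : 'I_n * 'I_n,
         [&& is_interval I', subinterval J I' & I'.2 - I'.1 < I.2 - I.1]
         ==> repeating S I']].

Definition SUS S p : {set 'I_n * 'I_n} := [set I | is_SUS S (p, p) I].

Definition PS S : {set 'I_n * 'I_n} := \bigcup_(p < n) SUS S p.

End PointSUS.

(* No string of length 3 over 3 letters has 3 + 3 - 2 = 4 point SUSs, hence the
   exclusion of n = sigma = 3 in the theorem. *)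
Lemma PS_length3_alphabet3 (T : 3.-tuple 'I_3) : #|PS T| <> 3 + 3 - 2.
Proof.
pose o0 : 'I_3 := @Ordinal 3 0 isT; pose o1 : 'I_3 := @Ordinal 3 1 isT.
pose o2 : 'I_3 := @Ordinal 3 2 isT.
have big3 (R : Type) (x : R) (op : Monoid.law x) (F : 'I_3 -> R) :
    \big[op/x]_(i < 3) F i = op (F o0) (op (F o1) (F o2)).
  rewrite !big_ord_recl big_ord0 Monoid.mulm1.
  by congr (op (F _) (op (F _) (F _))); apply: val_inj.
have cardE (U : finType) (D : {set U}) : #|D| = \sum_x (x \in D : nat).
  by rewrite -sum1_card big_mkcond; apply: eq_bigr => x _; case: (x \in D).
have sum3 (F : 'I_3 -> nat) : F o0 + (F o1 + F o2) = \sum_(i < 3) F i.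
  by rewrite big3.
have all3 (F : pred 'I_3) : F o0 && (F o1 && F o2) = [forall i, F i].
  by rewrite -[LHS](big3 _ true andb) big_andE; apply: eq_forallb.
have has3 (F : pred 'I_3) : F o0 || (F o1 || F o2) = [exists i, F i].
  by rewrite -[LHS](big3 _ false orb) big_orE; apply: eq_existsb.
pose occ w := let F i : nat := take (size w) (drop i T) == w in F o0 + (F o1 + F o2).
have occE w : nocc T w = occ w.
  rewrite /occ [RHS](sum3 (fun i => take (size w) (drop i T) == w : nat)).
  by rewrite /nocc cardE; apply: eq_bigr => i _; rewrite inE.
pose P p (I : 'I_3 * 'I_3) (i j : 'I_3) :=
  [&& i <= j, subinterval (p, p) (i, j) & j - i < I.2 - I.1]
  ==> (i <= j) && (2 <= occ (substring T (i, j))).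
pose Q p I i := P p I i o0 && (P p I i o1 && P p I i o2).
pose sus p I := [&& is_interval I, occ (substring T I) == 1,
  subinterval (p, p) I & Q p I o0 && (Q p I o1 && Q p I o2)].
have susE p I : is_SUS T (p, p) I = sus p I.
  rewrite /is_SUS /sus /unique occE -andbA; do 3!congr andb.
  rewrite (all3 (Q p I)); apply/forallP/forallP => [h i|h [i j]].
    rewrite /Q (all3 (P p I i)); apply/forallP => j.
    by have := h (i, j); rewrite /repeating occE.
  by have := h i; rewrite /Q (all3 (P p I i)) /repeating occE => /forallP/(_ j).
pose F i j : nat := sus o0 (i, j) || (sus o1 (i, j) || sus o2 (i, j)).
pose G i := F i o0 + (F i o1 + F i o2).
have -> : #|PS T| = G o0 + (G o1 + G o2).
  rewrite (sum3 G) /G; under [RHS]eq_bigr => i _ do rewrite (sum3 (F i)).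
  rewrite pair_big cardE; apply: eq_bigr => -[i j] _; congr nat_of_bool.
  rewrite (has3 (fun p => sus p (i, j))).
  by apply/bigcupP/existsP => -[p]; rewrite ?inE ?susE; exists p; rewrite ?inE ?susE.
rewrite {}/G {}/F {susE}/sus {}/Q {}/P {occE}/occ.
case: T => -[|a [|b [|c [|//]]]] //= sT.
by move: a b c sT; do 3![case=> [[|[|[|//]]] ?]] => ?; vm_compute.
Qed.

(* Main.v *)
Require Import Defs.
From mathcomp Require Import all_boot.
From mathcomp Require Import zify.

(** Take [T = a^m b_1 a b_2 a ... a b_k] with pairwise distinct letters [b_i],
    [k = sigma - 1] and [m = n + 3 - 2 sigma].  An interval is unique iff it
    meets some [b_i] or is the whole block [a^m] (the latter only if [m >= 2],
    or [m = k = 1]).  Hence each [b_i] contributes itself, each [a] between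
    [b_i] and [b_{i+1}] contributes [b_i a] and [a b_{i+1}], and the [m]
    positions of the block contribute the [m - 1] proper suffixes of the block
    extended by [b_1], plus one interval starting at position 0.  The total is
    [k + 2 (k - 1) + m = n + sigma - 2].  For [m = 0] the letter [a] must still
    occur twice, which fails only for [n = sigma = 3]. *)

Set Implicit Arguments.
Unset Strict Implicit.
Unset Printing Implicit Defensive.

Section Occurrences.

Variables (A : eqType) (n : nat) (S : n.-tuple A).

(** The bound on [k] excludes copies cut off by the end of [S], where [take] returns a shorter
    word. *)
Lemma occurrenceP (x0 : A) (i j k : 'I_n) : i <= j ->
  reflect (k + (j - i) < n /\
           forall d, d <= j - i -> nth x0 S (k + d) = nth x0 S (i + d))
    (take (size (substring S (i, j))) (drop k S) == substring S (i, j)).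
Proof.
move=> leij; have ltjn := ltn_ord j; have ltkn := ltn_ord k.
rewrite /substring /= size_takel ?size_drop ?size_tuple; last by lia.
apply: (iffP eqP) => [eqS|[ltkjn eqS]].
  have := congr1 size eqS; rewrite !size_take_min !size_drop size_tuple => szE.
  split=> [|d led]; first by lia.
  have := congr1 (fun s => nth x0 s d) eqS.
  by rewrite !nth_take ?nth_drop //; lia.
apply: (@eq_from_nth _ x0) => [|d].
  by rewrite !size_take_min !size_drop size_tuple; lia.
rewrite size_take_min => ltd; rewrite !nth_take ?nth_drop; try lia.
by apply: eqS; lia.
Qed.

Lemma nocc_substring_gt0 (i j : 'I_n) : i <= j -> 0 < nocc S (substring S (i, j)).
Proof.
move=> leij; apply/card_gt0P; exists i; rewrite inE.
by apply/(occurrenceP (tnth S i) _ leij); split=> //; have := ltn_ord j; lia.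
Qed.

Lemma repeatingE (i j : 'I_n) :
  repeating S (i, j) = (i <= j) && ~~ unique S (i, j).
Proof.
rewrite /repeating /unique /is_interval /=; case: (leqP i j) => //= leij.
by have := nocc_substring_gt0 leij; lia.
Qed.

Lemma uniqueP (x0 : A) (i j : 'I_n) : i <= j ->
  reflect (forall k : nat, k + (j - i) < n ->
     (forall d, d <= j - i -> nth x0 S (k + d) = nth x0 S (i + d)) -> k = i)
    (unique S (i, j)).
Proof.
move=> leij; rewrite /unique /is_interval /= leij /=.
have occ_i : i \in [set k : 'I_n | take (size (substring S (i, j))) (drop k S)
                                   == substring S (i, j)].
  by rewrite inE; apply/(occurrenceP x0 _ leij); split=> //; have := ltn_ord j; lia.
apply: (iffP cards1P) => [[q eq_q] k ltk eqS|uniq_i].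
  have ltkn : k < n by lia.
  have: Ordinal ltkn \in [set k : 'I_n |
      take (size (substring S (i, j))) (drop k S) == substring S (i, j)].
    by rewrite inE; apply/(occurrenceP x0 _ leij).
  by move: occ_i; rewrite eq_q !inE => /eqP-> /eqP<-.
exists i; apply/setP => k; rewrite !inE.
apply/(occurrenceP x0 _ leij)/eqP => [[ltk eqS]|->]; first exact/val_inj/uniq_i.
by split=> //; have := ltn_ord j; lia.
Qed.

End Occurrences.

Section Construction.

Variables (n sigma m : nat).
Hypotheses (n_ge2 : 2 <= n) (sigma_ge2 : 2 <= sigma).
Hypothesis mE : m + 2 * sigma = n + 3.
Hypothesis not33 : ~ (n = 3 /\ sigma = 3).

(** Coding: a is 0 and b_i is i, placed at position m + 2 (i - 1). *)
Definition letter (i : nat) : nat :=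
  if (m <= i) && ~~ odd (i - m) then (i - m)./2.+1 else 0.

(** From position m on, every other letter is a b, so two adjacent positions always include one;
    hence the disjunct [i < j]. *)
Definition uniq_spec (i j : nat) : bool :=
  (m <= j) && [|| i < m, ~~ odd (i - m) | i < j]
  || [&& i == 0, j.+1 == m & (2 <= m) || (sigma == 2)].

Lemma letter_gt0 i : (0 < letter i) = (m <= i) && ~~ odd (i - m).
Proof. by rewrite /letter; case: ifP. Qed.

Lemma letter_inj i j : 0 < letter i -> letter j = letter i -> j = i.
Proof. by rewrite /letter; do 2!case: ifP; lia. Qed.

Lemma uniq_specP i j : i <= j < n ->
  reflect (forall k, k + (j - i) < n ->
     (forall d, d <= j - i -> letter (k + d) = letter (i + d)) -> k = i)
    (uniq_spec i j).
Proof.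
move=> ltijn; apply: (iffP idP) => [|uniq_ij].
  case/orP=> [hmark|/and3P[/eqP i0 /eqP jm m_big]] k ltk eqL.
    (* A b inside the interval occurs only once in the string, which fixes the position of any
       copy. *)
    have [q [leiq mq]] : exists q, i <= q <= j /\ 0 < letter q.
      have [ltim|leim] := ltnP i m; first by exists m; rewrite letter_gt0; lia.
      have [oddi|eveni] := boolP (odd (i - m)); last by exists i; rewrite letter_gt0; lia.
      by exists i.+1; rewrite letter_gt0; lia.
    have ledq : q - i <= j - i by lia.
    have := eqL _ ledq; rewrite subnKC; last by lia.
    by move/(letter_inj mq); lia.
  case: (posnP k) => [|k_gt0]; first by lia.
  (* A copy of a^m starting inside the block would cover b_1 at position m. Past the block no two
     letters a are adjacent, which settles m >= 2; if m = 1, then n = 2 and only b_1 is left. *)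
  have [ltkm|lemk] := ltnP k m.
    have : m - k <= j - i by lia.
    by move/eqL; rewrite /letter; do 2!case: ifP; lia.
  have h0 : 0 <= j - i by [].
  have := eqL _ h0.
  have [m2|m1] := leqP 2 m.
    have h1 : 1 <= j - i by lia.
    by have := eqL _ h1; rewrite /letter; do 4!case: ifP; lia.
  by rewrite /letter; do 2!case: ifP; lia.
apply/negPn/negP; rewrite /uniq_spec => nspec.
have shift k : k <> i -> k + (j - i) < n ->
    (forall d, d <= j - i -> letter (k + d) = letter (i + d)) -> False.
  by move=> neki ltk /(uniq_ij _ ltk).
have [ltjm|lemj] := ltnP j m.
  have [eqjm|nejm] := eqVneq j.+1 m; last first.
    by apply: (shift i.+1) => [||d led]; rewrite /letter; do 2?case: ifP; lia.
  case: (posnP i) => [i0|i_gt0].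
    (* Here m = 1 and sigma >= 3, so a recurs between b_1 and b_2. *)
    by apply: (shift 2) => [||d led]; rewrite /letter; do 2?case: ifP; lia.
  by apply: (shift i.-1) => [||d led]; rewrite /letter; do 2?case: ifP; lia.
(* What remains is a single a between two letters b. *)
case: (posnP m) => [m0|m_gt0]; last first.
  by apply: (shift 0) => [||d led]; rewrite /letter; do 2?case: ifP; lia.
have [i1|nei1] := eqVneq i 1.
  (* Now n = 2 sigma - 3 is odd and not 3, so n >= 5 and position 3 holds another a. *)
  by apply: (shift 3) => [||d led]; rewrite /letter; do 2?case: ifP; lia.
by apply: (shift 1) => [||d led]; rewrite /letter; do 2?case: ifP; lia.
Qed.

Definition sus_spec (p i j : nat) : Prop :=
  [/\ i <= p <= j, j < n, uniq_spec i j &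
      forall i' j', i' <= p <= j' -> j' < n -> j' - i' < j - i ->
        ~~ uniq_spec i' j'].

(* The indices [e < m] enumerate the SUSs of the block [a^m]; the following
   ones run through [b_1], [b_1 a], [a b_2], [b_2], [b_2 a], ... *)
Definition sus_enum (e : nat) : nat * nat :=
  if e < m then
    if e == 0 then (0, if (m == 1) && (sigma != 2) then 1 else m.-1) else (e, m)
  else (m + 2 * (e - m) %/ 3, m + (2 * (e - m) + 2) %/ 3).

(** The sum of the two endpoints strictly increases with the index. *)
Lemma sus_enum_inj e f : sus_enum e = sus_enum f -> e = f.
Proof.
move=> eqef; have := congr1 fst eqef; have := congr1 snd eqef.
by rewrite /sus_enum; do ?case: ifP => ? /=; lia.
Qed.

Lemma sus_enum_bound e : e < n + sigma - 2 ->
  (sus_enum e).1 < n /\ (sus_enum e).2 < n.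
Proof. by rewrite /sus_enum => lte; do ?case: ifP => ? /=; lia. Qed.

Lemma sus_enum_spec e : e < n + sigma - 2 ->
  exists2 p, p < n & sus_spec p (sus_enum e).1 (sus_enum e).2.
Proof.
(* Indices m + 3t, m + 3t + 1 and m + 3t + 2 stand for b, ba and ab. The first serves position m +
   2t, the other two the a at m + 2t + 1. *)
move=> lte; exists (if e < m then e else m + (2 * (e - m) + 1) %/ 3).
  by case: ifP; lia.
rewrite /sus_enum; have [ltem|leme] := ltnP e m.
  case: (posnP e) => [e0|e_gt0] /=.
    case: ifP => ?; split; rewrite /uniq_spec => *; lia.
  by split; rewrite /uniq_spec => *; lia.
by split; rewrite /uniq_spec /= => *; lia.
Qed.

Lemma sus_spec_enum p i j : p < n -> sus_spec p i j ->
  exists2 e, e < n + sigma - 2 & sus_enum e = (i, j).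
Proof.
move=> ltpn [ipj ltjn uij min_ij].
have [ltpm|lemp] := ltnP p m.
  (* The interval from p to m contains b_1, so it bounds the length of every SUS for p. *)
  have lejim : j - i <= m - p.
    have := min_ij p m; rewrite /uniq_spec; lia.
  have [ltjm|lemj] := ltnP j m.
    move: uij; rewrite /uniq_spec => uij.
    exists 0; rewrite /sus_enum; do ?case: ifP => ?; try lia.
    by congr pair; lia.
  have [eip ejm] : i = p /\ j = m by lia.
  case: (posnP p) => [p0|p_gt0].
    (* The block itself is shorter than [0, m], so [0, m] survives only if the block repeats, that
       is, m = 1 and sigma > 2. *)
    have := min_ij 0 m.-1; rewrite /uniq_spec => min0.
    exists 0; rewrite /sus_enum; do ?case: ifP => ?; try lia.
    by congr pair; lia.
  exists p; rewrite /sus_enum; do ?case: ifP => ?; try lia.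
  by congr pair; lia.
have [oddp|evenp] := boolP (odd (p - m)).
  have lejim : j - i <= 1.
    have := min_ij p.-1 p; rewrite /uniq_spec; lia.
  move: uij; rewrite /uniq_spec => uij.
  (* For p = m + 2t + 1 the half is 3t + 1, the index of ba; ab, which starts at p, comes next. *)
  exists (m + (3 * (p - m))./2 + (i == p)); first by lia.
  rewrite /sus_enum; case: ifP => ?; first by lia.
  by congr pair; lia.
have lejim : j - i <= 0.
  have := min_ij p p; rewrite /uniq_spec; lia.
exists (m + (3 * (p - m))./2); first by lia.
rewrite /sus_enum; case: ifP => ?; first by lia.
by congr pair; lia.
Qed.

End Construction.

Theorem theorem4 (n sigma : nat) (hn : 2 <= n) (hsigma : 2 <= sigma)
    (hsigma_n : 2 * sigma <= n + 3) (hexc : ~ (n = 3 /\ sigma = 3)) :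
  exists T : n.-tuple 'I_sigma, #|PS T| = n + sigma - 2.
Proof.
have [m mE] : exists m, m + 2 * sigma = n + 3 by exists (n + 3 - 2 * sigma); lia.
have letter_lt (i : 'I_n) : letter m i < sigma.
  by have := ltn_ord i; rewrite /letter; case: ifP; lia.
pose T := [tuple Ordinal (letter_lt i) | i < n].
pose x0 : 'I_sigma := Ordinal (ltnW hsigma).
have nthT i : i < n -> nth x0 T i = letter m i :> nat.
  move=> ltin; have -> : nth x0 T i = tnth T (Ordinal ltin) by rewrite (tnth_nth x0).
  by rewrite tnth_mktuple.
have uniqT (i j : 'I_n) : i <= j -> unique T (i, j) = uniq_spec sigma m i j.
  move=> leij; have ltij : i <= j < n by rewrite leij ltn_ord.
  apply/(uniqueP T x0 leij)/(uniq_specP hn hsigma mE hexc ltij) => uniq_ij k ltk eqk;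
    apply: uniq_ij => // d led; [apply: val_inj => /=|]; have := eqk d led.
    by rewrite !nthT //; lia.
  by move/(congr1 val); rewrite /= !nthT //; lia.
have susT (p i j : 'I_n) : reflect (sus_spec n sigma m p i j) ((i, j) \in SUS T p).
  rewrite inE /is_SUS /subinterval /=.
  apply: (iffP and3P) => [[uij ipj /forallP min_ij]|[ipj ltjn uij min_ij]].
    have leij : i <= j by lia.
    split=> // [|i' j' ipj' ltj' short]; first by rewrite -uniqT.
    have lti' : i' < n by lia.
    have leij' : Ordinal lti' <= Ordinal ltj' by rewrite /=; lia.
    have := min_ij (Ordinal lti', Ordinal ltj').
    by rewrite repeatingE uniqT /is_interval //= ipj' short leij' /=; lia.
  have leij : i <= j by lia.
  split=> //; first by rewrite uniqT.
  apply/forallP => -[i' j']; apply/implyP; rewrite /is_interval /= => /and3P[leij' ipj' short].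
  by rewrite repeatingE leij' uniqT //; apply: min_ij.
exists T; pose N := n + sigma - 2.
have enum_lt (e : 'I_N) := sus_enum_bound hn hsigma mE hexc (ltn_ord e).
pose F (e : 'I_N) := (Ordinal (enum_lt e).1, Ordinal (enum_lt e).2).
have F_inj : injective F.
  move=> e f [eq1 eq2]; apply/val_inj/(sus_enum_inj hn hsigma mE hexc).
  by rewrite [LHS]surjective_pairing eq1 eq2 -surjective_pairing.
(* As [F] is injective, it remains to see that its image is [PS T]. *)
rewrite -[RHS](card_ord N) -(card_imset _ F_inj).
congr #|pred_of_set _|; apply/setP => -[i j].
apply/bigcupP/imsetP => [[p _ /susT susp]|[e _ [-> ->]]].
  have [e lte eqe] := sus_spec_enum hn hsigma mE hexc (ltn_ord p) susp.
  by exists (Ordinal lte) => //; congr pair; apply: val_inj; rewrite /= eqe.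
have [p ltp susp] := sus_enum_spec hn hsigma mE hexc (ltn_ord e).
by exists (Ordinal ltp) => //; apply/susT.
Qed.
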